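(* Let (P) be the two-stage linear adaptive robust optimization problem described in the context, with $\bm{d}=\bm{0}$. Let $p\in\mathbb{N}$ and let $(f_{\bm{w}})_{\bm{w}\in\mathbb{R}^p}$ be a family of decision rules with $f_{\bm{w}}\in\mathcal{R}^{L,n_y}$ for every $\bm{w}\in\mathbb{R}^p$. Suppose that for every adaptive robustly feasible $\bm{x}$ there exists $\bm{w}\in\mathbb{R}^p$ such that $(\bm{x},f_{\bm{w}}(\cdot))$ is adaptive robustly feasible to (P). Then any $\bm{x}^{\ast}$ that is Pareto Robustly Optimal (PRO) to the static robust optimization problem obtained after plugging in the decision rule structure $\bm{y}(\bm{z})=f_{\bm{w}}(\bm{z})$, namely $$\min_{\bm{x}\in\mathbb{R}^{n_x},\,\bm{w}\in\mathbb{R}^p}\ \max_{\bm{z}\in U}\ \bm{c}(\bm{z})^{\top}\bm{x}\quad\text{s.t.}\quad \bm{A}(\bm{z})\bm{x}+\bm{B}f_{\bm{w}}(\bm{z})\le\bm{r}(\bm{z})\ \ \forall\bm{z}\in U,$$ is Pareto Adaptive Robustly Optimal (PARO) to (P).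
   Context: Problem (P): $\min_{\bm{x},\bm{y}(\cdot)}\max_{\bm{z}\in U}\ \bm{c}(\bm{z})^{\top}\bm{x}+\bm{d}^{\top}\bm{y}(\bm{z})$ subject to $\bm{A}(\bm{z})\bm{x}+\bm{B}\bm{y}(\bm{z})\le \bm{r}(\bm{z})$ for all $\bm{z}\in U$. Here $U\subseteq\mathbb{R}^L$ is compact and convex with nonempty relative interior; $\bm{x}\in\mathbb{R}^{n_x}$ (Stage-1 decision); $\bm{y}\in\mathcal{R}^{L,n_y}$ (Stage-2 decision rule), where $\mathcal{R}^{L,n_y}$ is the set of measurable functions $\mathbb{R}^L\to\mathbb{R}^{n_y}$ that are bounded on compact sets; $\bm{B}\in\mathbb{R}^{m\times n_y}$ and $\bm{d}\in\mathbb{R}^{n_y}$ are constant; $\bm{A}(\bm{z})\in\mathbb{R}^{m\times n_x}$, $\bm{r}(\bm{z})\in\mathbb{R}^m$, $\bm{c}(\bm{z})\in\mathbb{R}^{n_x}$ depend affinely on $\bm{z}$. A pair $(\bm{x},\bm{y}(\cdot))$ is adaptive robustly feasible (ARF) if it satisfies all constraints of (P); $\bm{x}$ is ARF if some $\bm{y}(\cdot)\in\mathcal{R}^{L,n_y}$ makes $(\bm{x},\bm{y}(\cdot))$ ARF, and $\mathcal{X}$ is the set of ARF $\bm{x}$. $\mathrm{OPT}$ is the optimal (worst-case) value of (P). Standing assumptions: $\mathcal{X}\ne\emptyset$ and $\mathrm{OPT}$ is finite. A pair is adaptive robustly optimal (ARO) if it is ARF and $\bm{c}(\bm{z})^{\top}\bm{x}+\bm{d}^{\top}\bm{y}(\bm{z})\le\mathrm{OPT}$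 for all $\bm{z}\in U$. A pair $(\bm{x},\bm{y}(\cdot))$ is PARO if it is ARO and there is no ARO pair $(\bar{\bm{x}},\bar{\bm{y}}(\cdot))$ with $\bm{c}(\bm{z})^{\top}\bar{\bm{x}}+\bm{d}^{\top}\bar{\bm{y}}(\bm{z})\le \bm{c}(\bm{z})^{\top}\bm{x}+\bm{d}^{\top}\bm{y}(\bm{z})$ for all $\bm{z}\in U$ and with strict inequality for some $\bar{\bm{z}}\in U$. A Stage-1 decision $\bm{x}$ is PARO if there exists $\bm{y}(\cdot)$ such that $(\bm{x},\bm{y}(\cdot))$ is PARO. PRO: for a static robust problem $\min_{\bm{x}\in\mathcal{S}}\max_{\bm{z}\in U}f(\bm{x},\bm{z})$, a solution is robustly optimal if it attains the optimal worst-case value; a robustly optimal $\bm{x}$ is PRO if there is no robustly optimal $\bar{\bm{x}}$ with $f(\bar{\bm{x}},\bm{z})\le f(\bm{x},\bm{z})$ for all $\bm{z}\in U$ and $f(\bar{\bm{x}},\bar{\bm{z}})<f(\bm{x},\bar{\bm{z}})$ for some $\bar{\bm{z}}\in U$. In the static problem of the claim the objective does not depend on $\bm{w}$; $\bm{x}^{\ast}$ is called PRO to it if it is PRO to $\min_{\bm{x}\in\mathcal{X}_f}\max_{\bm{z}\in U}\bm{c}(\bm{z})^{\top}\bm{x}$, where $\mathcal{X}_f$ is the set of $\bm{x}$ for which some $\bm{w}$ makes $(\bm{x},\bm{w})$ feasible. *)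

(* Defs.v *)
From HB Require Import structures.
From mathcomp Require Import all_boot all_order all_algebra.
From mathcomp Require Import all_classical all_reals all_analysis.

Set Implicit Arguments.
Unset Strict Implicit.
Unset Printing Implicit Defensive.

Import Order.TTheory GRing.Theory Num.Theory.
Import numFieldNormedType.Exports.

Local Open Scope classical_set_scope.
Local Open Scope ring_scope.

Definition dotv (R : realType) (n : nat) (u v : 'cV[R]_n) : R :=
  (u^T *m v) 0 0.

Definition vec_le (R : realType) (n : nat) (u v : 'cV[R]_n) : Prop :=
  forall i, u i 0 <= v i 0.

Definition affine_map (R : realType) (V W : lmodType R) (f : V -> W) : Prop :=
  exists (g : {linear V -> W}) (b : W), forall v, f v = g v + b.

Definition affine_hull (R : realType) (V : lmodType R) (A : set V) : set V :=
  [set v | exists (k : nat) (t : 'I_k -> R) (u : 'I_k -> V),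
    [/\ forall i, A (u i), \sum_i t i = 1 & v = \sum_i t i *: u i]].

(* The matrix ball is the sup-norm ball, which induces the Euclidean topology *)
Definition rel_interior (R : realType) (n : nat) (A : set 'cV[R]_n) :
    set 'cV[R]_n :=
  [set v | A v /\
    exists2 e : R, 0 < e & ball v e `&` affine_hull A `<=` A].

Section StaticRobust.
Context {R : realType} {X Z : Type}.
Implicit Types (S : set X) (U : set Z) (f : X -> Z -> R).

(* [max] over the uncertainty set is read as a supremum in the extended reals *)
Definition worst_case U f (x : X) : \bar R :=
  ereal_sup [set (f x z)%:E | z in U].

Definition robust_value S U f : \bar R :=
  ereal_inf [set worst_case U f x | x in S].

Definition robustly_optimal S U f (x : X) : Prop :=
  S x /\ worst_case U f x = robust_value S U f.

Definition PRO S U f (x : X) : Prop :=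
  robustly_optimal S U f x /\
  ~ exists xb : X,
      [/\ robustly_optimal S U f xb,
          forall z, U z -> f xb z <= f x z &
          exists2 zb, U zb & f xb zb < f x zb].

End StaticRobust.

(* Borel measurable, and bounded on compact sets *)
Definition decision_rule (R : realType) (L ny : nat) :
    set ('cV[R]_L -> 'cV[R]_ny) :=
  [set y |
    measurable_fun [set: g_sigma_algebraType (@open 'cV[R]_L)]
      (y : g_sigma_algebraType (@open 'cV[R]_L) ->
           g_sigma_algebraType (@open 'cV[R]_ny)) /\
    forall K : set 'cV[R]_L, compact K -> [bounded y z | z in K]].

(* min over (x, y(.)), max over z in U of c(z)^T x + d^T y(z)
   subject to A(z) x + B y(z) <= r(z) for all z in U *)
Record two_stage (R : realType) (L nx ny m : nat) := TwoStage {
  unc : set 'cV[R]_L ;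
  cost : 'cV[R]_L -> 'cV[R]_nx ;
  rcost : 'cV[R]_ny ;
  tech : 'cV[R]_L -> 'M[R]_(m, nx) ;
  recourse : 'M[R]_(m, ny) ;
  rhs : 'cV[R]_L -> 'cV[R]_m ;
  unc_compact : compact unc ;
  unc_convex : convex_set unc ;
  unc_rint : rel_interior unc !=set0 ;
  cost_affine : affine_map cost ;
  tech_affine : affine_map tech ;
  rhs_affine : affine_map rhs
}.

Section TwoStageTheory.
Context {R : realType} {L nx ny m : nat}.
Variable P : two_stage R L nx ny m.
Implicit Types (x : 'cV[R]_nx) (y : 'cV[R]_L -> 'cV[R]_ny) (z : 'cV[R]_L).

Definition objective (xy : 'cV[R]_nx * ('cV[R]_L -> 'cV[R]_ny)) z : R :=
  dotv (cost P z) xy.1 + dotv (rcost P) (xy.2 z).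

Definition constraints x y : Prop :=
  forall z, unc P z ->
    vec_le (tech P z *m x + recourse P *m y z) (rhs P z).

Definition ARF : set ('cV[R]_nx * ('cV[R]_L -> 'cV[R]_ny)) :=
  [set xy | decision_rule xy.2 /\ constraints xy.1 xy.2].

Definition ARF1 : set 'cV[R]_nx := [set x | exists y, ARF (x, y)].

Definition OPT : \bar R := robust_value ARF (unc P) objective.

Definition ARO : set ('cV[R]_nx * ('cV[R]_L -> 'cV[R]_ny)) :=
  [set xy | ARF xy /\
    forall z, unc P z -> ((objective xy z)%:E <= OPT)%E].

Definition PARO : set ('cV[R]_nx * ('cV[R]_L -> 'cV[R]_ny)) :=
  [set xy | ARO xy /\
    ~ exists xyb,
        [/\ ARO xyb,
            forall z, unc P z -> objective xyb z <= objective xy z &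
            exists2 zb, unc P zb & objective xyb zb < objective xy zb]].

Definition PARO1 : set 'cV[R]_nx := [set x | exists y, PARO (x, y)].

Definition static_feasible (p : nat)
    (f : 'cV[R]_p -> 'cV[R]_L -> 'cV[R]_ny) : set ('cV[R]_nx * 'cV[R]_p) :=
  [set xw | constraints xw.1 (f xw.2)].

(* The objective does not involve w, so w is projected out *)
Definition PRO_static (p : nat)
    (f : 'cV[R]_p -> 'cV[R]_L -> 'cV[R]_ny) : set 'cV[R]_nx :=
  PRO [set x | exists w, static_feasible f (x, w)] (unc P)
      (fun x z => dotv (cost P z) x).

End TwoStageTheory.

(* Main.v *)
(* With d = 0 the objective ignores y, and f_feasible makes the Stage-1
   projection of the static feasible set equal to the set of ARF Stage-1
   decisions.  Hence both problems have the same optimal value, and an ARO pair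
   dominating (xstar, f w) would yield a Stage-1 decision dominating xstar in
   the static problem. *)
Require Import Defs.
From HB Require Import structures.
From mathcomp Require Import all_boot all_order all_algebra.
From mathcomp Require Import all_classical all_reals all_analysis.

Set Implicit Arguments.
Unset Strict Implicit.
Unset Printing Implicit Defensive.

Import Order.TTheory GRing.Theory.

Local Open Scope classical_set_scope.
Local Open Scope ring_scope.

Lemma dot0v (R : realType) (n : nat) (v : 'cV[R]_n) : dotv 0 v = 0.
Proof. by rewrite /dotv trmx0 mul0mx mxE. Qed.

Lemma worst_case_le (R : realType) (X Z : Type) (U : set Z) (f : X -> Z -> R)
    (x : X) (v : \bar R) :
  (worst_case U f x <= v)%E <-> forall z, U z -> ((f x z)%:E <= v)%E.
Proof.
split=> [le_v z Uz|le_v].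
  by apply: le_trans le_v; apply: ereal_sup_ubound; exists z.
by apply: ge_ereal_sup => _ [z Uz <-]; exact: le_v.
Qed.

(** Only the upper bound has content, since the worst case of a feasible [x] is never below the
    infimum [robust_value]. This turns attainment of the value into the pointwise bound by which
    [ARO] is defined. *)
Lemma robustly_optimalP (R : realType) (X Z : Type) (S : set X) (U : set Z)
    (f : X -> Z -> R) (x : X) :
  robustly_optimal S U f x <->
  S x /\ forall z, U z -> ((f x z)%:E <= robust_value S U f)%E.
Proof.
split=> [[Sx wcE]|[Sx /worst_case_le wc_le]]; split=> //.
  by apply/worst_case_le; rewrite wcE.
apply/eqP; rewrite eq_le wc_le /=.
by apply: ereal_inf_lbound; exists x.
Qed.

Section ZeroRecourseCost.
Context {R : realType} {L nx ny m : nat} {P : two_stage R L nx ny m}.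
Hypothesis rcost0 : rcost P = 0.

Let stage1_cost (x : 'cV[R]_nx) (z : 'cV[R]_L) := dotv (cost P z) x.

Lemma objective_rcost0 xy z : objective P xy z = stage1_cost xy.1 z.
Proof. by rewrite /objective rcost0 dot0v addr0. Qed.

(** Both infima run over the same values: a pair has the worst case of its Stage-1 part, and each
    [x] in [ARF1 P] extends to a feasible pair. *)
Lemma OPT_rcost0 : OPT P = robust_value (ARF1 P) (unc P) stage1_cost.
Proof.
have wcE xy : worst_case (unc P) (objective P) xy =
              worst_case (unc P) stage1_cost xy.1.
  by congr ereal_sup; apply: eq_imagel => z _; rewrite objective_rcost0.
congr ereal_inf; apply/seteqP; split=> [_ [[x y] xyP <-]|_ [x [y xyP] <-]].
  by exists x; [exists y | rewrite wcE].
by exists (x, y); rewrite ?wcE.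
Qed.

Lemma ARO_rcost0 x y :
  ARO P (x, y) <->
  ARF P (x, y) /\ robustly_optimal (ARF1 P) (unc P) stage1_cost x.
Proof.
split=> [[xyP le_opt]|[xyP /robustly_optimalP[_ le_opt]]]; split=> //.
  apply/robustly_optimalP; split; first by exists y.
  by move=> z Uz; rewrite -OPT_rcost0 -(objective_rcost0 (x, y)); exact: le_opt.
by move=> z Uz; rewrite OPT_rcost0 objective_rcost0; exact: le_opt.
Qed.

(** Any feasible [y] serves, as it does not affect the objective. Of a dominating pair only the
    Stage-1 part [xb] is kept, and it already dominates [x]. *)
Lemma PARO_rcost0 x y :
  ARF P (x, y) -> PRO (ARF1 P) (unc P) stage1_cost x -> PARO P (x, y).
Proof.
move=> xyP [x_opt x_pareto]; split; first by apply/ARO_rcost0.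
move=> [[xb yb] [/ARO_rcost0[_ xb_opt] le_obj [zb Uzb lt_obj]]].
apply: x_pareto; exists xb; split=> // [z Uz|].
  by have := le_obj z Uz; rewrite !objective_rcost0.
by exists zb => //; rewrite !objective_rcost0 in lt_obj.
Qed.

End ZeroRecourseCost.

(** An equality of sets lets PRO be transferred by rewriting. [f_rule] makes each [f w] an
    admissible Stage-2 rule; the converse inclusion is the feasibility hypothesis. *)
Lemma static_feasible_ARF1 (R : realType) (L nx ny m : nat)
    (P : two_stage R L nx ny m) (p : nat)
    (f : 'cV[R]_p -> 'cV[R]_L -> 'cV[R]_ny) :
  (forall w, decision_rule (f w)) ->
  (forall x, ARF1 P x -> exists w, ARF P (x, f w)) ->
  [set x | exists w, static_feasible P f (x, w)] = ARF1 P.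
Proof.
move=> f_rule f_feasible; apply/seteqP; split=> [x [w xwP]|x].
  by exists (f w); split; [exact: f_rule | exact: xwP].
by move=> /f_feasible[w [_ xwP]]; exists w.
Qed.

Theorem theorem3 (R : realType) (L nx ny m : nat)
    (P : two_stage R L nx ny m)
    (ARF_nonempty : ARF1 P !=set0)
    (OPT_finite : OPT P \is a fin_num)
    (rcost0 : rcost P = 0)
    (p : nat) (f : 'cV[R]_p -> 'cV[R]_L -> 'cV[R]_ny)
    (f_rule : forall w, decision_rule (f w))
    (f_feasible : forall x, ARF1 P x -> exists w, ARF P (x, f w))
    (xstar : 'cV[R]_nx) :
  PRO_static P f xstar -> PARO1 P xstar.
Proof.
rewrite /PRO_static (static_feasible_ARF1 f_rule f_feasible) => xstar_PRO.
(* Robust optimality of [xstar] includes [ARF1 P xstar], so [f_feasible] supplies a rule [f w]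
   completing it to a feasible pair. *)
have [[/f_feasible[w xwP] _] _] := xstar_PRO.
by exists (f w); apply: PARO_rcost0.
Qed.
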